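(* Let $a\in\mathbb{N}^n$ and $r\in\mathbb{N}$ be such that $a$ is nonincreasing, $\max_i a_i\le r(n-1)$, and $\sum_{i\le n}a_i$ is even. Let $m=\max\{i: a_i\ge r(i-1)+1\}$. Let $(\mathrm{C1}_k)$ and $(\mathrm{C2}_k)$ denote the inequalities $$(\mathrm{C1}_k)\qquad \sum_{i\le k}a_i\le rk(k-1)+\sum_{i>k}\min\{rk,a_i\},$$ $$(\mathrm{C2}_k)\qquad \sum_{i\le k}a_i\le\sum_{i\le k}\min\{r(k-1),a_i\}+\sum_{i>k}\min\{rk,a_i\}.$$ The following are equivalent: (1) $a$ is $r$-multigraphic; (2) $a\trianglelefteq a^C$; (3) $(\mathrm{C1}_k)$ holds for all $k\in\{1,\dots,n\}$; (4) $(\mathrm{C1}_k)$ holds for $k=m$ and for all $k\in C(a)$ such that $k<m$; (5) $(\mathrm{C2}_k)$ holds for $k=m$ and for all $k\in C(a)$ such that $k<m$; (6) $(\mathrm{C2}_m)$ holds, and $j\,a'_j+\sum_{i>j}a'_i\le\sum_{i\le r a'_j}(a'_i-1)$ for all $j\in C(a')$ such that $a'_j<m$.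
   Context: $\mathbb{N}=\{0,1,2,\dots\}$. An $r$-multigraph is a loopless undirected graph allowing multiple edges, but with at most $r$ edges connecting each pair of vertices; $a\in\mathbb{N}^n$ is $r$-multigraphic if there exists an $r$-multigraph on $n$ vertices with degrees $a_1,\dots,a_n$ (edges counted with multiplicity). In the definition of $m$ the index $i$ ranges over $\{1,\dots,n\}$; if $a=(0,\dots,0)$ the set is empty and $m$ is read as $0$ (with empty sums equal to $0$). For $c\in\mathbb{N}^n$, the conjugate $c'=(c'_1,c'_2,\dots)$ is $c'_k=\#\{i:c_i\ge k\}$. For $x,y\in\mathbb{N}^n$, $x\trianglelefteq y$ means $\sum_{i\le k}x_i\le\sum_{i\le k}y_i$ for all $k\in\{1,\dots,n\}$. For matrices $A,B\in\mathbb{N}^{n\times n}$, $A\trianglelefteq B$ means that their vectors of column sums $\alpha,\beta$ satisfy $\alpha\trianglelefteq\beta$; if a finite set of such matrices has a unique maximal element with respect to $\trianglelefteq$, its generalized conjugate is the vector of column sums of this maximal element. $a^C\in\mathbb{N}^n$ is the generalized conjugate of the set of matrices in $\mathbb{N}^{n\times n}$ with zero diagonal, row sums $a$, and all entries at most $r$ (it exists when $\max_i a_i\le r(n-1)$); explicitly, $\sum_{i\le k}a^C_i=\sum_{i\le k}\min\{r(k-1),a_i\}+\sum_{i>k}\min\{rk,a_i\}$. For nonincreasing $x\in\mathbb{N}^n$, the set of corners is $C(x)=\{k:1\le k\le n,\ x_k>x_{k+1}\}$ with the convention $x_{n+1}=0$; likewise $C(a')=\{j\ge1:a'_j>a'_{j+1}\}$.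 *)

(* Defs.v *)
From HB Require Import structures.
From mathcomp Require Import all_boot all_order all_algebra.

Set Implicit Arguments.
Unset Strict Implicit.
Unset Printing Implicit Defensive.

(* The 1-based entry x_i; it is 0 past the end, so x_{n+1} = 0. *)
Definition entry (x : seq nat) (i : nat) : nat := nth 0 x i.-1.

(* A finite multiset of 2-element subsets of V: [mult e] is the number of
   parallel edges joining the two elements of e. *)
Record multigraph (V : finType) := Multigraph {
  mult :> {set V} -> nat;
  mult_loopless : forall e : {set V}, 0 < mult e -> #|e| = 2
}.

Definition degree (V : finType) (G : multigraph V) (v : V) : nat :=
  \sum_(e : {set V} | v \in e) mult G e.

Definition is_rmultigraph (r : nat) (V : finType) (G : multigraph V) : Prop :=
  forall e : {set V}, mult G e <= r.

Definition rmultigraphic (r n : nat) (a : n.-tuple nat) : Prop :=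
  exists2 G : multigraph 'I_n,
    is_rmultigraph r G & forall v : 'I_n, degree G v = tnth a v.

Definition dominated (n : nat) (x y : n.-tuple nat) : Prop :=
  forall k : nat, 1 <= k <= n ->
    \sum_(1 <= i < k.+1) entry x i <= \sum_(1 <= i < k.+1) entry y i.

Definition col_sums (n : nat) (A : 'M[nat]_n) : n.-tuple nat :=
  [tuple \sum_(i < n) A i j | j < n].

Definition row_sums (n : nat) (A : 'M[nat]_n) : n.-tuple nat :=
  [tuple \sum_(j < n) A i j | i < n].

Definition mx_dominated (n : nat) (A B : 'M[nat]_n) : Prop :=
  dominated (col_sums A) (col_sums B).

(* [mx_dominated] is only a preorder on matrices, hence this form of
   maximality. *)
Definition maximal_mx (n : nat) (S : 'M[nat]_n -> Prop) (A : 'M[nat]_n) : Prop :=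
  S A /\ forall B : 'M[nat]_n, S B -> mx_dominated A B -> mx_dominated B A.

Definition is_gen_conjugate (n : nat) (S : 'M[nat]_n -> Prop)
    (c : n.-tuple nat) : Prop :=
  exists2 A : 'M[nat]_n, unique (maximal_mx S) A & c = col_sums A.

Definition rmatrices (r n : nat) (a : n.-tuple nat) (A : 'M[nat]_n) : Prop :=
  [/\ forall i : 'I_n, A i i = 0,
      row_sums A = a
    & forall i j : 'I_n, A i j <= r].

Definition is_aC (r n : nat) (a c : n.-tuple nat) : Prop :=
  is_gen_conjugate (rmatrices r a) c.

Definition conjugate (c : seq nat) (k : nat) : nat := count (leq k) c.

Definition corner (n : nat) (x : n.-tuple nat) (k : nat) : bool :=
  (1 <= k <= n) && (entry x k.+1 < entry x k).

Definition conjugate_corner (c : seq nat) (j : nat) : bool :=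
  (1 <= j) && (conjugate c j.+1 < conjugate c j).

Definition max_entry (c : seq nat) : nat := \max_(x <- c) x.

(* Equal to 0 when no index qualifies. *)
Definition durfee (r n : nat) (a : n.-tuple nat) : nat :=
  \max_(1 <= i < n.+1 | r * (i - 1) + 1 <= entry a i) i.

Definition C1 (r n : nat) (a : n.-tuple nat) (k : nat) : Prop :=
  \sum_(1 <= i < k.+1) entry a i
    <= r * k * (k - 1) + \sum_(k.+1 <= i < n.+1) minn (r * k) (entry a i).

Definition C2 (r n : nat) (a : n.-tuple nat) (k : nat) : Prop :=
  \sum_(1 <= i < k.+1) entry a i
    <= \sum_(1 <= i < k.+1) minn (r * (k - 1)) (entry a i)
       + \sum_(k.+1 <= i < n.+1) minn (r * k) (entry a i).

(* The sum over all i > j stops at [max_entry a], beyond which a'_i = 0.  The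
   differences a'_i - 1 are taken in int to avoid truncated subtraction. *)
Definition conjugate_ineq (r n : nat) (a : n.-tuple nat) (j : nat) : Prop :=
  (((j * conjugate a j
       + \sum_(j.+1 <= i < (max_entry a).+1) conjugate a i)%N%:Z : int)
    <= \sum_(1 <= i < (r * conjugate a j).+1) ((conjugate a i)%:Z - 1))%R.

(* Main.v *)
Require Import Defs.
From HB Require Import structures.
From mathcomp Require Import all_boot all_order all_algebra.
From mathcomp Require Import zify.

Set Implicit Arguments.
Unset Strict Implicit.
Unset Printing Implicit Defensive.

(* Write f i for the 0-based entries of a and D(k) for the right-hand side minus
   the left-hand side of (C1_k).

   Sufficiency of (C1) is Choudum's induction: with p the last positive index
   and t < p the last index of the maximum (or p - 1), (C1) survives decreasing
   f t and f p by 1, parity of the sum being needed when f 0 <= r k.  A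
   realization of the smaller sequence is then completed by an edge t p or, if
   these are already r-fold, by edges t v and p w after removing an edge v w.

   The reduction to corners: D is nondecreasing beyond m, and up to m it is
   concave away from the corners.  For k <= m, (C1_k) and (C2_k) coincide.

   The left-packed matrix maximizes every prefix of every row, so it is the
   unique maximal one, and a is dominated by its column sums iff all (C2_k) hold.

   Finally, the corners k of a and j of a' correspond through k = a'_j and
   j = a_k; for such a pair with k < m the inequality in (6) is (C1_k). *)

(** * Nonincreasing sequences and sums over index ranges *)

Definition noninc (f : nat -> nat) : Prop := forall i j, i <= j -> f j <= f i.

Definition erdos_gallai (n r : nat) (f : nat -> nat) (k : nat) : Prop :=
  \sum_(0 <= i < k) f i
    <= r * k * (k - 1) + \sum_(k <= i < n) minn (r * k) (f i).

Lemma leq_sum_range (a b : nat) (F G : nat -> nat) :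
    (forall i, a <= i < b -> F i <= G i) ->
  \sum_(a <= i < b) F i <= \sum_(a <= i < b) G i.
Proof.
move=> leFG; rewrite [X in X <= _]big_nat_cond [X in _ <= X]big_nat_cond.
by apply: leq_sum => i; rewrite andbT => /leFG.
Qed.

Lemma sum_range_le_const (a b c : nat) (F : nat -> nat) :
  (forall i, F i <= c) -> \sum_(a <= i < b) F i <= (b - a) * c.
Proof.
move=> leFc; rewrite -sum_nat_const_nat.
by apply: leq_sum_range => i _; apply: leFc.
Qed.

Lemma sum_indicator_le (P : pred nat) (n : nat) : \sum_(0 <= j < n) P j <= n.
Proof.
have := @sum_range_le_const 0 n 1 P; rewrite muln1 subn0; apply=> i.
by case: (P i).
Qed.

(** A downward closed [P] holds on an initial segment, so counting its elements locates where it
    stops. This replaces every choice of a last index with a property. *)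
Lemma sum_threshold (P : pred nat) (n : nat) :
    (forall i j, i <= j -> P j -> P i) ->
  forall i, i < n -> (i < \sum_(0 <= j < n) P j) = P i.
Proof.
move=> Pdown; elim: n => // n IH i lein.
rewrite big_nat_recr //=; have [Pn|nPn] := boolP (P n).
  rewrite (eq_big_nat _ _ (F2 := fun=> 1)) => [|j /andP[_ ltjn]]; last first.
    by rewrite (Pdown j n (ltnW ltjn) Pn).
  by rewrite sum_nat_const_nat muln1 subn0 addn1 lein (Pdown i n).
rewrite addn0; move: lein; rewrite ltnS leq_eqVlt => /predU1P[->|/IH //].
rewrite (negbTE nPn); apply/negbTE; rewrite -leqNgt.
exact: sum_indicator_le.
Qed.

Lemma sum_indicator (a b x : nat) : \sum_(a <= i < b) (i == x) = (a <= x < b).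
Proof.
have [/andP[ax xb]|nin] := boolP (a <= x < b).
  rewrite (big_cat_nat ax (ltnW xb)) /= [X in _ + X]big_ltn // eqxx.
  by rewrite !big1_seq // => i; rewrite mem_index_iota; lia.
by rewrite big1_seq // => i /=; rewrite mem_index_iota; lia.
Qed.

(** * Realizing matrices and the necessity of (C1) *)

Definition realizable (n r : nat) (f : nat -> nat) : Prop :=
  exists M : nat -> nat -> nat,
  [/\ forall i j, M i j = M j i, forall i, M i i = 0, forall i j, M i j <= r
    & forall i, i < n -> \sum_(0 <= j < n) M i j = f i].

(** Split the first [k] rows at column [k]. Inside, a row has [k - 1] off-diagonal entries, each at
    most [r]; outside, a column [j] contributes at most [r * k] and, by symmetry, at most [f j]. *)
Lemma realizable_erdos_gallai (n r : nat) (f : nat -> nat) (k : nat) :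
  realizable n r f -> k <= n -> erdos_gallai n r f k.
Proof.
case=> M [Msym Mdiag Mr Mf] lekn.
rewrite /erdos_gallai.
rewrite (eq_big_nat _ _ (F2 := fun i => \sum_(0 <= j < n) M i j)); last first.
  by move=> i /andP[_ ik]; rewrite Mf //; lia.
under eq_bigr => i _ do rewrite (big_cat_nat (n := k)) //=.
rewrite big_split /=; apply: leq_add.
  apply: (@leq_trans (\sum_(0 <= i < k) r * (k - 1))).
    apply: leq_sum_range => i /andP[_ ik].
    apply: (@leq_trans (\sum_(0 <= j < k) r * (j != i))).
      by apply: leq_sum => j _; case: eqVneq => [->|_]; rewrite ?Mdiag ?muln1.
    rewrite -big_distrr /= leq_mul2l; apply/orP; right.
    have := sum_indicator 0 k i; rewrite ik /= => E.
    suff: \sum_(0 <= j < k) (j == i) + \sum_(0 <= j < k) (j != i) = k by lia.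
    rewrite -big_split /= (eq_bigr (fun=> 1)); last by move=> j _; case: eqP.
    by rewrite sum_nat_const_nat; lia.
  by rewrite sum_nat_const_nat; lia.
rewrite exchange_big_nat /=.
apply: leq_sum_range => j /andP[kj jn]; rewrite leq_min; apply/andP; split.
  rewrite [r * k]mulnC -[in X in _ <= X](subn0 k).
  exact: sum_range_le_const.
rewrite -(Mf j) // [X in _ <= X](big_cat_nat (n := k)) //=.
by under eq_bigr => i _ do rewrite Msym; apply: leq_addr.
Qed.

(** * Adding an edge to a realization *)

Definition edge (x y i j : nat) : nat :=
  ((i == x) && (j == y)) || ((i == y) && (j == x)).

Lemma edge_sym x y i j : edge x y i j = edge x y j i.
Proof. by rewrite /edge; lia. Qed.

Lemma edge_diag x y i : x != y -> edge x y i i = 0.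
Proof.
move=> xy; rewrite /edge.
by case: eqVneq => [->|_]; rewrite ?(negbTE xy) ?andbF.
Qed.

Lemma sum_edge (n x y i : nat) : x != y -> x < n -> y < n ->
  \sum_(0 <= j < n) edge x y i j = (i == x) + (i == y).
Proof.
move=> xy xn yn.
rewrite (eq_bigr (fun j => (i == x) * (j == y) + (i == y) * (j == x))).
  by rewrite big_split /= -!big_distrr /= !sum_indicator xn yn !muln1.
by move=> j _; rewrite /edge; case: eqP; case: eqP; case: eqP; case: eqP => //=; lia.
Qed.

(* If [t] and [p] are already joined by [r] edges, an edge [v w] is traded for
   [t v] and [p w]. *)
Lemma realizable_add_edge (n r t p : nat) (f : nat -> nat) :
    t < p < n -> f t < r * p ->
    (forall v, v < p -> v != t -> f p < f v) ->
  realizable n r f ->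
  realizable n r (fun i => f i + (i == t) + (i == p)).
Proof.
move=> /andP[tp pn] ft fp [M [Msym Mdiag Mr Mf]].
have [Mtp|] := ltnP (M t p) r.
  exists (fun i j => M i j + edge t p i j); split=> [i j|i|i j|i i_n].
  - by rewrite Msym edge_sym.
  - by rewrite Mdiag edge_diag //; lia.
  - have := Mr i j; rewrite /edge.
    case: eqP => [->|_]; case: eqP => [->|_] //=; rewrite ?Mdiag; try lia.
    case: eqP => [?|_]; case: eqP => [?|_] //=; subst; rewrite ?(Msym p); lia.
  - by rewrite big_split /= Mf // sum_edge; lia.
move=> Mtp; have {}Mtp : M t p = r by apply/eqP; rewrite eqn_leq Mr.
(* Otherwise row [t] would have [r] in all [p] columns up to [p] other than [t], against
   [f t < r * p]. *)
have [v [vt vp Mtv]] : exists v, [/\ v != t, v < p & M t v < r].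
  have [/hasP[v]|/hasPn nh] :=
      boolP (has (fun v => (v != t) && (M t v < r)) (iota 0 p)).
    by rewrite mem_iota => vp /andP[? ?]; exists v; split => //; lia.
  have : \sum_(0 <= j < p.+1) r * (j != t) <= \sum_(0 <= j < p.+1) M t j.
    apply: leq_sum_range => j /andP[_ jp].
    case: (eqVneq j t) => [|jt] //=; first by rewrite muln0.
    case: (eqVneq j p) => [->|jp']; first by rewrite Mtp muln1.
    by have := nh j; rewrite mem_iota jt -leqNgt muln1 /=; apply; lia.
  have : \sum_(0 <= j < p.+1) M t j <= f t.
    by rewrite -(Mf t) ?[X in _ <= X](big_cat_nat (n := p.+1)) ?leq_addr //; lia.
  have : \sum_(0 <= j < p.+1) (j == t) + \sum_(0 <= j < p.+1) (j != t) = p.+1.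
    rewrite -big_split /= (eq_bigr (fun=> 1)); last by move=> j _; case: eqP.
    by rewrite sum_nat_const_nat; lia.
  by rewrite sum_indicator -big_distrr /=; nia.
have [w [wn wv wp Mw]] : exists w, [/\ w < n, w != v, w != p & M p w < M v w].
  have [/hasP[w]|/hasPn nh] :=
      boolP (has (fun w => [&& w != v, w != p & M p w < M v w]) (iota 0 n)).
    by rewrite mem_iota => ? /and3P[? ? ?]; exists w; split => //; lia.
  (* Without such a [w], row [v] is at most row [p] outside the columns [v] and [p]. The two added
     terms, equal by symmetry, balance these columns, whence [f v <= f p]. *)
  suff: f v + M p v <= f p + M v p by have := fp v vp vt; rewrite (Msym p); lia.
  have vn : v < n by lia.
  rewrite -(Mf v) // -(Mf p) //.
  have := sum_indicator 0 n v; have := sum_indicator 0 n p.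
  rewrite pn vn /= => Ep Ev.
  rewrite -[M p v]muln1 -[M v p]muln1 -{1}Ev -Ep.
  rewrite !big_distrr /= -!big_split /=.
  apply: leq_sum_range => j /andP[_ jn].
  case: (eqVneq j v) => [->|jv] /=.
    rewrite Mdiag; lia.
  case: (eqVneq j p) => [->|jp] /=; first by rewrite Mdiag; lia.
  by have := nh j; rewrite mem_iota jv jp -leqNgt !muln0 !addn0; apply; lia.
have wt : w != t.
  apply/eqP => E; move: Mw; rewrite E (Msym p) Mtp => Hr.
  by have := Mr v t; lia.
pose N i j := M i j + edge t v i j + edge p w i j.
(* The subtraction removes an existing edge and is never truncated, because [M v w] is positive. *)
have NE i j : N i j - edge v w i j + edge v w i j = N i j.
  apply: subnK; rewrite /N /edge.
  case: (eqVneq i v) => [->|_]; case: (eqVneq j w) => [->|_] //=; try lia.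
  case: (eqVneq i w) => [->|_]; case: (eqVneq j v) => [->|_] //=; try lia.
  by rewrite (Msym w); lia.
exists (fun i j => N i j - edge v w i j); split=> [i j|i|i j|i i_n].
- by rewrite /N Msym ![edge _ _ i j]edge_sym.
- by rewrite /N Mdiag !edge_diag // eq_sym.
- have := Mr i j; have := Mr v w; rewrite /N /edge => Mvw.
  case: (boolP ((i == t) && (j == v) || (i == v) && (j == t))) => [|_].
    by move=> /orP[] /andP[/eqP-> /eqP->]; rewrite ?(Msym v); lia.
  case: (boolP ((i == p) && (j == w) || (i == w) && (j == p))) => [|_].
    by move=> /orP[] /andP[/eqP-> /eqP->]; rewrite ?(Msym w); lia.
  by lia.
- have : \sum_(0 <= j < n) (N i j - edge v w i j) + ((i == v) + (i == w)) =
         f i + ((i == t) + (i == v)) + ((i == p) + (i == w)).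
    rewrite -(@sum_edge n v w) //; [|lia..].
    rewrite -big_split /= (eq_bigr (N i)) // /N !big_split /= Mf // !sum_edge; lia.
  by lia.
Qed.

(** * Sufficiency of (C1) *)

(** For positive [k], the quotient of [minn (r * k) x] by [k] is the minimum of [r] and [x / k],
    which is nonincreasing in [k]. *)
Lemma minn_mulS_le (r k x : nat) :
  k * minn (r * k.+1) x <= k.+1 * minn (r * k) x.
Proof.
rewrite !minnMr leq_min !geq_min (mulnCA k) (mulnCA k.+1) (mulnC k k.+1) leqnn.
by rewrite leq_mul2r leqnSn !orbT.
Qed.

(** For [t < k] the left side drops at least as much as the right. For [k <= t] the left side is the
    constant sum [k * c], and the right may drop by up to 2, according to how [c] and [f p] compare
    with [r * k]. *)
Lemma erdos_gallai_remove_edge (n r t p : nat) (f g : nat -> nat) :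
    noninc f -> ~~ odd (\sum_(0 <= i < n) f i) ->
    t < p < n -> (forall i, i <= t -> f i = f 0) ->
    0 < f p -> (forall i, p < i -> f i = 0) ->
    (forall i, f i = g i + (i == t) + (i == p)) ->
    (forall k, k <= n -> erdos_gallai n r f k) ->
  forall k, k <= n -> erdos_gallai n r g k.
Proof.
move=> fmono feven /andP[tp pn] ft fp0 fp fg EG k kn.
have sum_fg a b : \sum_(a <= i < b) f i =
    \sum_(a <= i < b) g i + (a <= t < b) + (a <= p < b).
  by rewrite (eq_bigr _ (fun i _ => fg i)) !big_split /= !sum_indicator.
have [->|k0] := posnP k; first by rewrite /erdos_gallai big_geq.
have EGk := EG k kn; rewrite /erdos_gallai in EGk *.
have [pk|kp] := ltnP p k.
  have <- : \sum_(k <= i < n) minn (r * k) (f i) = \sum_(k <= i < n) minn (r * k) (g i).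
    rewrite [LHS]big_nat_cond [RHS]big_nat_cond; apply: eq_bigr => i.
    by rewrite andbT => /andP[ki _]; have := fg i; rewrite fp; [lia|lia].
  by apply: leq_trans EGk; rewrite sum_fg; lia.
have [tk|kt] := ltnP t k.
  have : \sum_(k <= i < n) minn (r * k) (f i) <=
         \sum_(k <= i < n) minn (r * k) (g i) + 1.
    have -> : 1 = \sum_(k <= i < n) (i == p) by rewrite sum_indicator kp pn.
    rewrite -big_split /=; apply: leq_sum_range => i /andP[ki _].
    by have := fg i; lia.
  by move: EGk; rewrite sum_fg; lia.
have gf i : g i <= f i by rewrite fg; lia.
pose c := f 0.
have Sf : \sum_(0 <= i < k) f i = k * c.
  rewrite (eq_big_nat _ _ (F2 := fun=> c)).
    by rewrite sum_nat_const_nat subn0.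
  by move=> i /andP[_ ik]; apply: ft; lia.
have Sg : \sum_(0 <= i < k) g i <= k * c.
  by rewrite -Sf; apply: leq_sum_range.
have fk : f k = c by apply: ft.
have kn1 : k < n by lia.
have [ck|kc] := leqP c (r * k).
  have mS (h : nat -> nat) : (forall i, h i <= f i) ->
      \sum_(k <= i < n) minn (r * k) (h i) = \sum_(k <= i < n) h i.
    move=> hf; apply: eq_bigr => i _; apply/minn_idPr.
    by apply: leq_trans (hf i) (leq_trans (fmono 0 i _) ck).
  rewrite mS //; have := sum_fg k n; rewrite (ltn_trans tp pn) kt kp pn /=.
  rewrite big_ltn // fk.
  set R := (\sum_(k.+1 <= i < n) f i) => Eg.
  have R1 : 1 <= R.
    rewrite /R (bigD1_seq p) ?iota_uniq ?mem_index_iota //=; first by lia.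
    by apply/andP; split; lia.
  move: feven; rewrite (big_cat_nat (n := k)) //= Sf big_ltn // fk -/R.
  clear - k0 ck Eg R1 Sg.
  (* Nothing is truncated here, so [(k - 1) * c + 2 <= r * k * (k - 1) + R] is needed. It can fail
     only if [R = 1] and [k = 1] or [c = r * k]; both make the total [k.+1 * c + 1] odd. *)
  have [R2|R2] := leqP 2 R; first by nia.
  have -> : R = 1 by lia.
  have [kc1|] := ltnP ((k - 1) * c) (r * k * (k - 1)); first by nia.
  move=> h odd_.
  have : (k == 1) || (c == r * k).
    case: eqVneq => //= k1; rewrite eqn_leq ck /=.
    by move: h; rewrite mulnC leq_mul2l; lia.
  case/orP => /eqP E; exfalso; move: odd_; rewrite E; first by lia.
  by rewrite addnA -mulSnr mulnCA oddD oddM oddM /= andNb andbF.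
have [pk|pk] := leqP (f p) (r * k).
  suff : k * c < r * k * (k - 1) + \sum_(k <= i < n) minn (r * k) (f i).
    have : \sum_(k <= i < n) minn (r * k) (f i) <=
           \sum_(k <= i < n) minn (r * k) (g i) + 1.
      have -> : 1 = \sum_(k <= i < n) (i == p) by rewrite sum_indicator kp pn.
      rewrite -big_split /=; apply: leq_sum_range => i /andP[ki _].
      have := fg i; case: (eqVneq i t) => [->|] /=; last by lia.
      by rewrite ft // -/c; lia.
    by lia.
  (* The right side drops by at most 1, so (C1_k) is needed strictly. It follows from the inequality
     at [k.+1] scaled by [k / (k + 1)], where the comparison of tails is strict at [p] since
     [0 < f p <= r * k]. *)
  have := EG k.+1 kn1; rewrite /erdos_gallai big_nat_recr //= Sf fk.
  rewrite [in X in _ -> X]big_ltn // fk.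
  have -> : minn (r * k) c = r * k by lia.
  set T := \sum_(_ <= i < n) _; set S' := \sum_(_ <= i < n) _ => h.
  have : k * T < k.+1 * S'.
    rewrite /T /S' !big_distrr /=.
    rewrite -addn1; have -> : 1 = \sum_(k.+1 <= i < n) (i == p).
      by rewrite sum_indicator pn; lia.
    rewrite -big_split /=; apply: leq_sum_range => i _.
    case: eqVneq => [->|_]; last by rewrite addn0 minn_mulS_le.
    have -> : minn (r * k) (f p) = f p by lia.
    have -> : minn (r * k.+1) (f p) = f p by nia.
    by rewrite mulSn; lia.
  clear - h k0; nia.
(* Now both lowered entries exceed [r * k], so truncation hides the change. *)
have -> : \sum_(k <= i < n) minn (r * k) (g i) =
          \sum_(k <= i < n) minn (r * k) (f i).
  apply: eq_bigr => i _; have := fg i; case: (eqVneq i t) => [->|] /=.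
    by rewrite ft // -/c; lia.
  by case: (eqVneq i p) => [->|] /=; lia.
by apply: leq_trans EGk; rewrite Sf.
Qed.

Lemma erdos_gallai_realizable (n r : nat) (f : nat -> nat) :
    noninc f -> (forall i, n <= i -> f i = 0) ->
    ~~ odd (\sum_(0 <= i < n) f i) ->
    (forall k, k <= n -> erdos_gallai n r f k) ->
  realizable n r f.
Proof.
move: {2}(\sum_(0 <= i < n) f i) (leqnn (\sum_(0 <= i < n) f i)) => N.
elim: N f => [|N IH] f.
  move=> S0 fmono fn _ _; exists (fun _ _ => 0); split=> // i i_n.
  rewrite big1 //; move: S0; rewrite leqn0 sum_nat_seq_eq0 => /allP/(_ i).
  by rewrite mem_index_iota i_n /= => /(_ isT) /eqP.
move=> SN fmono fn feven EG.
have [f0|f0] := posnP (f 0).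
  exists (fun _ _ => 0); split=> // i i_n.
  by rewrite big1 //; have := fmono 0 i (leq0n _); lia.
have n0 : 0 < n by case: (posnP n) => // n0; rewrite fn ?n0 // in f0.
pose pos := \sum_(0 <= j < n) (0 < f j).
pose top := \sum_(0 <= j < n) (f 0 <= f j).
have posE i : i < n -> (i < pos) = (0 < f i).
  by apply: (@sum_threshold (fun j => 0 < f j)) => x y /fmono; lia.
have topE i : i < n -> (i < top) = (f 0 <= f i).
  by apply: (@sum_threshold (fun j => f 0 <= f j)) => x y /fmono; lia.
have posn : pos <= n by apply: sum_indicator_le.
have pos0 : 0 < pos by rewrite posE.
have top0 : 0 < top by rewrite topE.
(* The minimum with [p] keeps [t] below [p] when the maximum is still attained at [p]. *)
pose p := pos.-1; pose t := (minn top p).-1.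
have fp0 : 0 < f p by rewrite -posE /p; lia.
have fp i : p < i -> f i = 0.
  move=> pi; have [/fn //|i_n] := leqP n i.
  by have := posE i i_n; rewrite /p in pi; lia.
(* This is the inequality of index 1. It forces [p] to be positive, and later gives [g t < r * p],
   as trading edges requires. *)
have f0p : f 0 <= r * p.
  have := EG 1 n0; rewrite /erdos_gallai big_nat1 subnn muln0 add0n muln1.
  move=> /leq_trans; apply; rewrite (big_cat_nat (n := p.+1)) //=; [|rewrite /p; lia..].
  rewrite [X in _ + X]big1_seq ?addn0.
    apply: leq_trans (@leq_sum_range _ _ _ (fun=> r) _) _ => [i _|].
      exact: geq_minl.
    by rewrite sum_nat_const_nat subSS subn0 mulnC.
  by move=> i; rewrite mem_index_iota => /andP[_ /andP[pi _]]; rewrite fp ?minn0.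
have p0 : 0 < p by case: (posnP p) => // E; rewrite E in f0p; lia.
have tp : t < p < n by rewrite /t /p in p0 *; lia.
have ft i : i <= t -> f i = f 0.
  move=> it; apply/eqP; rewrite eqn_leq fmono // -topE; rewrite /t in it tp; lia.
have ftS i : t < i -> i < p -> f i < f 0.
  by move=> ti ip; have := topE i; rewrite /t in ti tp; lia.
pose g i := f i - (i == t) - (i == p).
have fg i : f i = g i + (i == t) + (i == p).
  rewrite /g; case: (eqVneq i t) => [it|_]; case: (eqVneq i p) => [ip|_] /=; try lia.
    by rewrite it ft //; lia.
  by rewrite ip; lia.
have sum_fg : \sum_(0 <= i < n) f i = \sum_(0 <= i < n) g i + 2.
  rewrite (eq_bigr _ (fun i _ => fg i)) !big_split /= !sum_indicator /=.
  by case/andP: tp => /ltn_trans H /[dup] /H -> ->; rewrite -addnA.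
have [M [Msym Mdiag Mr Mf]] : realizable n r (fun i => g i + (i == t) + (i == p)).
  apply: realizable_add_edge => //.
  - by have := fg t; rewrite ft // eqxx; lia.
  - move=> v vp vt; have := fg v; have := fg p; have := fmono v p (ltnW vp).
    by rewrite (negbTE vt) eqxx; lia.
  apply: IH.
  - by lia.
  (* Lowering keeps the order: entries strictly between [t] and [p] are below the maximum, [p] is
     lowered along with [t], and entries after [p] vanish. *)
  - move=> i j; rewrite leq_eqVlt => /predU1P[-> //|ij].
    have := fg i; have := fg j; have := fmono i j (ltnW ij).
    have := ft t (leqnn t); have := ftS j.
    case: (eqVneq i t) => [it|_]; case: (eqVneq i p) => [ip|_] /=; try lia.
      by rewrite it in ij *; case: (ltngtP j p) => [jp|jp|->]; rewrite ?(fp j jp); lia.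
    by rewrite (fp j) //; lia.
  - by move=> i /fn fi; have := fg i; lia.
  - by move: feven; rewrite sum_fg oddD addbF.
  - exact: (erdos_gallai_remove_edge fmono feven tp ft fp0 fp fg EG).
by exists M; split => // i i_n; rewrite Mf // -fg.
Qed.

(** * Comparing (C1) with (C2) *)

(** The right-hand side of (C2_k), which is also the sum of the first [k] column sums of the
    left-packed matrix. *)
Definition packed_sum (n r : nat) (f : nat -> nat) (k : nat) : nat :=
  \sum_(0 <= i < k) minn (r * (k - 1)) (f i)
  + \sum_(k <= i < n) minn (r * k) (f i).

(* Only the [l] first terms exceed [r (k - 1)], and the inequality of index [k]
   follows from the one of index [l]. *)
Lemma erdos_gallai_packed (n r : nat) (f : nat -> nat) :
    noninc f -> (forall k, k <= n -> erdos_gallai n r f k) ->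
  forall k, k <= n -> \sum_(0 <= i < k) f i <= packed_sum n r f k.
Proof.
move=> fmono EG k kn.
pose P i := r * (k - 1) < f i.
pose l := \sum_(0 <= i < k) P i.
have lE i : i < k -> (i < l) = P i.
  by apply: sum_threshold => x y xy; rewrite /P; have := fmono x y xy; lia.
have lk : l <= k by apply: sum_indicator_le.
have := EG l (leq_trans lk kn); rewrite /erdos_gallai /packed_sum.
rewrite (big_cat_nat (m := 0) (n := l) (p := k)) //=.
rewrite [X in _ -> _ <= X + _](big_cat_nat (n := l)) //=.
rewrite [X in _ <= _ + X -> _](big_cat_nat (n := k)) //=.
have -> : \sum_(l <= i < k) minn (r * (k - 1)) (f i) = \sum_(l <= i < k) f i.
  apply: eq_big_nat => i /andP[li ik]; apply/minn_idPr.
  by have := lE i ik; rewrite /P; lia.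
have -> : \sum_(0 <= i < l) minn (r * (k - 1)) (f i) = l * (r * (k - 1)).
  rewrite -[in RHS](subn0 l) -sum_nat_const_nat; apply: eq_big_nat => i /andP[_ il].
  by apply/minn_idPl; rewrite ltnW // -/(P i) -lE ?il //; lia.
have : \sum_(l <= i < k) minn (r * l) (f i) <= (k - l) * (r * l).
  by apply: sum_range_le_const => i; apply: geq_minl.
have : \sum_(k <= i < n) minn (r * l) (f i) <= \sum_(k <= i < n) minn (r * k) (f i).
  by apply: leq_sum => i _; rewrite leq_min geq_minr andbT geq_min leq_mul2l lk orbT.
(* The last summand pays for the terms of index from [l] to [k] on the right of the inequality at
   [l]. *)
have -> : l * (r * (k - 1)) = r * l * (l - 1) + (k - l) * (r * l).
  by case: (posnP l) => [->|l0]; nia.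
lia.
Qed.

Lemma packed_erdos_gallai (n r : nat) (f : nat -> nat) (k : nat) :
  \sum_(0 <= i < k) f i <= packed_sum n r f k -> erdos_gallai n r f k.
Proof.
move/leq_trans; apply; rewrite leq_add2r.
have -> : r * k * (k - 1) = (k - 0) * (r * (k - 1)) by lia.
rewrite -sum_nat_const_nat.
by apply: leq_sum => i _; apply: geq_minl.
Qed.

(** * Reduction of (C1) to [m] and the corners *)

Section Durfee.

Variables (n r m : nat) (f : nat -> nat).
Hypotheses (fmono : noninc f) (mn : m <= n).
Hypothesis mE : forall i, i < n -> (i < m) = (r * i < f i).

(** For [i < k <= m], [f i >= f (k - 1) > r * (k - 1)], so the first minimum is constant. *)
Lemma packed_sum_le_durfee (k : nat) : k <= m ->
  packed_sum n r f k =
  r * k * (k - 1) + \sum_(k <= i < n) minn (r * k) (f i).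
Proof.
move=> km; congr (_ + _).
have -> : r * k * (k - 1) = (k - 0) * (r * (k - 1)) by lia.
rewrite -sum_nat_const_nat; apply: eq_big_nat => i /andP[_ ik]; apply/minn_idPl.
have := mE (i := k - 1); have := fmono (i := i) (j := k - 1); lia.
Qed.

Let L k := \sum_(0 <= i < k) f i.
Let R k := r * k * (k - 1) + \sum_(k <= i < n) minn (r * k) (f i).

Let L_recr k : L k.+1 = L k + f k.
Proof. by rewrite /L big_nat_recr. Qed.

(** The quadratic term together with the truncated terms at [k] and [k.+1] has second difference
    zero; each term of the remaining tail is concave, as a minimum of a linear function and a
    constant. *)
Lemma erdos_gallai_concave (k : nat) : k.+1 < m ->
  R k + R k.+2 <= R k.+1 + R k.+1.
Proof.
move=> km; have k2n : k.+2 <= n by lia.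
have fk1 : r * k.+1 < f k.+1 by rewrite -mE //; lia.
have fk0 : r * k.+1 < f k by apply: leq_trans fk1 (fmono _).
rewrite /R big_ltn; last by lia.
rewrite big_ltn; last by lia.
rewrite [X in _ <= _ + X + _]big_ltn; last by lia.
rewrite [X in _ <= _ + (_ + X)]big_ltn; last by lia.
have -> : minn (r * k.+1) (f k.+1) = r * k.+1 by lia.
have -> : minn (r * k) (f k) = r * k by lia.
have -> : minn (r * k) (f k.+1) = r * k by lia.
set S0 := \sum_(_ <= i < n) _; set S2 := \sum_(_ <= i < n) _.
set S1 := \sum_(_ <= i < n) _.
have : S0 + S2 <= S1 + S1.
  by rewrite /S0 /S1 /S2 -!big_split /=; apply: leq_sum => i _; lia.
by nia.
Qed.

(* A violation at [k.+1] but not at [k] would, by concavity and away from the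
   corners, worsen all the way up to [m]. *)
Lemma erdos_gallai_corners :
    erdos_gallai n r f m ->
    (forall k, 0 < k < m -> f k < f k.-1 -> erdos_gallai n r f k) ->
  forall k, k <= n -> erdos_gallai n r f k.
Proof.
move=> EGm EGc.
(* With [D = R - L], the hypotheses say that [D] is negative at [k.+1] and smaller there than at
   [k]; they are written additively to avoid truncated subtraction. *)
have worsen d k : k + d.+1 = m -> R k.+1 < L k.+1 -> L k + R k.+1 < R k + L k.+1 -> False.
  elim: d k => [|d IH] k kd bad worse.
    by rewrite addn1 in kd; move: EGm; rewrite -kd /erdos_gallai -/(L _) -/(R _); lia.
  have k1m : k.+1 < m by lia.
  (* A drop here would make [k.+1] a corner, where no violation is allowed. Hence [L] is affine here
     and [D] inherits the concavity of [R]. *)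
  have fk : f k.+1 = f k.
    apply/eqP; rewrite eqn_leq fmono // leqNgt; apply/negP => /(EGc k.+1).
    by rewrite k1m => /(_ isT); rewrite /erdos_gallai -/(L _) -/(R _); lia.
  have := erdos_gallai_concave k1m; have := L_recr k; have := L_recr k.+1.
  by move=> ? ? ?; apply: (IH k.+1); lia.
have lem k : k <= m -> erdos_gallai n r f k.
  elim: k => [_|k IH km]; first by rewrite /erdos_gallai big_geq.
  rewrite /erdos_gallai -/(L _) -/(R _) leqNgt; apply/negP => bad.
  apply: (worsen (m - k.+1) k) => //; first by lia.
  by have := IH (ltnW km); rewrite /erdos_gallai -/(L _) -/(R _); lia.
move=> k kn; have [/lem //|/ltnW mk] := leqP k m.
elim: k mk kn => [|k IH]; first by rewrite leqn0 => /eqP <-.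
rewrite leq_eqVlt => /predU1P[<- //|]; rewrite ltnS => mk kn.
have := IH mk (ltnW kn); rewrite /erdos_gallai big_nat_recr //=.
rewrite [\sum_(k <= i < n) _]big_ltn //.
(* Passing to [k.+1] adds [f k] on the left and at least [2 * r * k - f k] on the right. *)
have fk : f k <= r * k by have := mE kn; lia.
have : \sum_(k.+1 <= i < n) minn (r * k) (f i) <=
       \sum_(k.+1 <= i < n) minn (r * k.+1) (f i) by apply: leq_sum => i _; lia.
by have -> : minn (r * k) (f k) = f k; [lia|nia].
Qed.

End Durfee.

(** * Multigraphs as symmetric matrices *)

(** Sets that are not pairs have multiplicity 0, and the pairs containing [v] are indexed
    injectively by the other endpoint. *)
Lemma degreeE (V : finType) (G : multigraph V) (v : V) :
  degree G v = \sum_(w | w != v) mult G [set v; w].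
Proof.
rewrite /degree (bigID (fun e : {set V} => #|e| == 2)) /= [X in _ + X]big1 ?addn0.
  rewrite -(big_imset (h := fun w => [set v; w]) (fun e => mult G e)) /=.
    apply: eq_bigl => e; apply/andP/imsetP => [[ve /cards2P[x [y [xy eE]]]]|[w wv ->]].
      move: ve; rewrite eE !inE => /orP[] /eqP->.
        by exists y => //; rewrite unfold_in eq_sym.
      by exists x; rewrite ?unfold_in // setUC.
    by move: wv; rewrite unfold_in eq_sym set21 cards2 => ->.
  move=> x y; rewrite !unfold_in => xv yv E.
  by have := set22 v x; rewrite E !inE (negbTE xv) /= => /eqP.
move=> e /andP[_ e2]; apply/eqP; rewrite -leqn0 leqNgt.
by apply: contra e2 => /mult_loopless ->.
Qed.

Lemma rmultigraphic_realizable (r n : nat) (a : n.-tuple nat) :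
  rmultigraphic r a <-> realizable n r (nth 0 a).
Proof.
split=> [[G Gr Gdeg]|[M [Msym Mdiag Mr Mf]]].
  (* For [i = j] the set has at most one element, so its multiplicity is 0. *)
  pose M i j := mult G [set x : 'I_n | (val x == i) || (val x == j)].
  have M0 i : M i i = 0.
    apply/eqP; rewrite -leqn0 leqNgt; apply/negP => /mult_loopless.
    apply/eqP; rewrite neq_ltn ltnS; apply/orP; left; apply/card_le1_eqP => x y.
    by rewrite !inE !orbb => /eqP xi /eqP yi; apply: val_inj; rewrite /= xi yi.
  exists M; split=> // [i j|i j|i i_n]; last 1 first.
  - pose v := Ordinal i_n; rewrite big_mkord (bigD1 v) //= M0 add0n.
    rewrite -[i]/(val v) -tnth_nth -Gdeg degreeE; apply: eq_bigr => w _.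
    by congr (mult G _); apply/setP => x; rewrite !inE.
  - by congr (mult G _); apply/setP => x; rewrite !inE orbC.
  - exact: Gr.
(* Summing over ordered pairs and halving avoids ordering the endpoints of [e]. *)
pose mu (e : {set 'I_n}) :=
  if #|e| == 2 then (\sum_(x in e) \sum_(y in e) M x y)./2 else 0.
have mu2 v w : v != w -> mu [set v; w] = M v w.
  move=> vw; have vw' : v \notin [set w] by rewrite inE.
  by rewrite /mu cards2 vw !(big_setU1 _ vw') !big_set1 /= !(big_setU1 _ vw') /=
             !big_set1 !Mdiag (Msym w) addn0 add0n addnn doubleK.
have mu_loopless e : 0 < mu e -> #|e| = 2 by rewrite /mu; case: eqP.
exists (Multigraph mu_loopless) => [e /=|v].
  have [/eqP/cards2P[x [y [xy ->]]]|] := eqVneq #|e| 2; first by rewrite mu2.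
  by rewrite /mu => /negbTE ->.
rewrite degreeE (tnth_nth 0) -Mf // big_mkord [RHS](bigD1 v) //= Mdiag add0n.
by apply: eq_bigr => w wv /=; rewrite mu2 // eq_sym.
Qed.

(** * The left-packed matrix and the generalized conjugate *)

(** Row [i] is filled greedily from the left with entries up to [r], skipping the diagonal. Here
    [j - (i < j)] counts the off-diagonal columns before [j], and truncated subtraction gives 0 once
    [x] is exhausted. *)
Definition packed_entry (r x i j : nat) : nat :=
  if j == i then 0 else minn r (x - r * (j - (i < j))).

Lemma sum_packed_entry (r x i k : nat) :
  \sum_(0 <= j < k) packed_entry r x i j = minn (r * (k - (i < k))) x.
Proof.
elim: k => [|k IH]; first by rewrite big_geq // muln0 min0n.
rewrite big_nat_recr //= IH /packed_entry.
case: eqVneq => [->|ki]; first by rewrite ltnn ltnSn addn0; congr minn; lia.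
have -> : (i < k.+1) = (i < k) by lia.
have -> : k.+1 - (i < k) = (k - (i < k)).+1 by lia.
by rewrite mulnS; lia.
Qed.

Definition packed_mx (r n : nat) (a : n.-tuple nat) : 'M[nat]_n :=
  \matrix_(i, j) packed_entry r (tnth a i) i j.

Definition row_prefix (n : nat) (A : 'M[nat]_n) (i : 'I_n) (k : nat) : nat :=
  \sum_(j < n | j < k) A i j.

Lemma row_prefix_recr (n : nat) (A : 'M[nat]_n) (i j : 'I_n) :
  row_prefix A i j.+1 = row_prefix A i j + A i j.
Proof.
rewrite /row_prefix (bigD1 j) //= addnC; congr (_ + _); apply: eq_bigl => l.
by rewrite -val_eqE /=; lia.
Qed.

Lemma col_sums_prefix (n : nat) (A : 'M[nat]_n) (k : nat) : k <= n ->
  \sum_(1 <= j < k.+1) entry (col_sums A) j = \sum_(i < n) row_prefix A i k.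
Proof.
move=> kn; rewrite big_add1 /= big_mkord (big_ord_widen n (fun j => entry _ j.+1)) //.
rewrite /row_prefix [RHS]exchange_big /=; apply: eq_bigr => j _.
by rewrite -[LHS]/(nth 0 (col_sums A) j) -tnth_nth tnth_mktuple.
Qed.

Lemma row_prefix_packed (r n : nat) (a : n.-tuple nat) (i : 'I_n) (k : nat) :
  k <= n -> row_prefix (packed_mx r a) i k = minn (r * (k - (i < k))) (tnth a i).
Proof.
move=> kn; rewrite /row_prefix -sum_packed_entry big_mkord (big_ord_widen n) //.
by apply: eq_bigr => j _; rewrite mxE.
Qed.

Lemma row_prefix_le (r n : nat) (a : n.-tuple nat) (B : 'M[nat]_n) (i : 'I_n)
    (k : nat) : rmatrices r a B ->
  k <= n -> row_prefix B i k <= row_prefix (packed_mx r a) i k.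
Proof.
case=> Bdiag Brow Br kn; rewrite row_prefix_packed // leq_min; apply/andP; split.
  apply: (@leq_trans (\sum_(j < n | j < k) r * (val j != val i))).
    apply: leq_sum => j _; case: (eqVneq (val j) (val i)) => [/val_inj ->|_].
      by rewrite Bdiag.
    by rewrite muln1.
  rewrite -(big_ord_widen n (fun j => r * (j != i))) // -big_distrr /= leq_mul2l.
  apply/orP; right.
  rewrite -(big_mkord xpredT (fun j => nat_of_bool (j != i))).
  have : \sum_(0 <= j < k) (j == i) + \sum_(0 <= j < k) (j != i) = k.
    rewrite -big_split /= (eq_bigr (fun=> 1)); last by move=> j _; case: eqP.
    by rewrite sum_nat_const_nat subn0 muln1.
  by rewrite sum_indicator; lia.
rewrite -Brow tnth_mktuple /row_prefix big_mkcond /=.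
by apply: leq_sum => j _; case: ifP.
Qed.

(** The bound on the maximum says that [n - 1] off-diagonal entries have room for each row sum. *)
Lemma packed_mx_rmatrices (r n : nat) (a : n.-tuple nat) :
  max_entry a <= r * (n - 1) -> rmatrices r a (packed_mx r a).
Proof.
move=> a_bound; split=> [i||i j]; first by rewrite mxE /packed_entry eqxx.
  apply: eq_from_tnth => i; rewrite tnth_mktuple.
  transitivity (row_prefix (packed_mx r a) i n).
    by apply: eq_bigl => j; rewrite ltn_ord.
  rewrite row_prefix_packed // ltn_ord; apply/minn_idPr; apply: leq_trans a_bound.
  by apply: (leq_bigmax_seq (F := id)) => //; apply: mem_tnth.
by rewrite mxE /packed_entry; case: ifP => // _; apply: geq_minl.
Qed.

(* The packed matrix maximizes every prefix of every row simultaneously. *)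
Lemma packed_mx_maximal (r n : nat) (a : n.-tuple nat) :
  max_entry a <= r * (n - 1) -> unique (maximal_mx (rmatrices r a)) (packed_mx r a).
Proof.
move=> /packed_mx_rmatrices SP.
have top B : rmatrices r a B -> mx_dominated B (packed_mx r a).
  move=> SB k /andP[_ kn]; rewrite !col_sums_prefix //.
  by apply: leq_sum => i _; apply: row_prefix_le.
split=> [|B [SB Bmax]]; first by split=> // B /top.
(* Each row prefix of [B] is at most the packed one, while maximality makes their totals agree; so
   they agree row by row, and entries are differences of prefixes. *)
have prefE i k : k <= n -> row_prefix B i k = row_prefix (packed_mx r a) i k.
  case: k => [|k] kn; first by rewrite /row_prefix !big_pred0.
  have := Bmax _ SP (top B SB) k.+1 kn; rewrite !col_sums_prefix // => le1.
  have le2 l : row_prefix B l k.+1 <= row_prefix (packed_mx r a) l k.+1.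
    exact: row_prefix_le.
  apply/eqP; rewrite eqn_leq le2 leqNgt; apply/negP => lt.
  move: le1; rewrite leqNgt => /negP; apply.
  rewrite (bigD1 i) //= [X in _ < X](bigD1 i) //= -addSn leq_add //.
  by apply: leq_sum => l _.
apply/matrixP => i j; have := prefE i j.+1 (ltn_ord j).
by rewrite !row_prefix_recr prefE ?(ltnW (ltn_ord j)) // => /addnI.
Qed.

Lemma is_aCP (r n : nat) (a c : n.-tuple nat) : max_entry a <= r * (n - 1) ->
  is_aC r a c <-> c = col_sums (packed_mx r a).
Proof.
move=> /packed_mx_maximal U; split=> [[A [_ uA] ->]|->]; last by exists (packed_mx r a).
by congr col_sums; apply: uA; case: U.
Qed.

(** * Passage to 0-based entries, and the index [m] *)

Lemma sum_entry (x : seq nat) (F : nat -> nat) (b c : nat) :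
  \sum_(b.+1 <= i < c.+1) F (entry x i) = \sum_(b <= i < c) F (nth 0 x i).
Proof. by rewrite big_add1. Qed.

Lemma C1E (r n : nat) (a : n.-tuple nat) (k : nat) :
  C1 r a k <-> erdos_gallai n r (nth 0 a) k.
Proof. by rewrite /C1 (sum_entry a id) (sum_entry a (minn (r * k))). Qed.

Lemma C2E (r n : nat) (a : n.-tuple nat) (k : nat) :
  C2 r a k <-> \sum_(0 <= i < k) nth 0 a i <= packed_sum n r (nth 0 a) k.
Proof.
by rewrite /C2 (sum_entry a id) (sum_entry a (minn (r * k)))
           (sum_entry a (minn (r * (k - 1)))).
Qed.

Lemma sorted_nth_noninc (n : nat) (a : n.-tuple nat) :
  sorted geq a -> noninc (nth 0 a).
Proof.
move=> a_noninc i j ij; have [nj|jn] := leqP n j.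
  by rewrite (nth_default 0 (s := a)) // size_tuple.
apply: (sorted_leq_nth _ _ 0 a_noninc i j _ _ ij).
- by move=> x y z /= yx zx; apply: leq_trans zx yx.
- exact: leqnn.
- by rewrite inE size_tuple (leq_ltn_trans ij jn).
- by rewrite inE size_tuple.
Qed.

Lemma durfee_le (r n : nat) (a : n.-tuple nat) : durfee r a <= n.
Proof.
apply/bigmax_leqP_seq => i; rewrite mem_index_iota; lia.
Qed.

Lemma durfeeP (r n : nat) (a : n.-tuple nat) (i : nat) : sorted geq a ->
  i < n -> (i < durfee r a) = (r * i < nth 0 a i).
Proof.
move=> /sorted_nth_noninc fmono i_n; apply/idP/idP => [im|fi]; last first.
  apply: (leq_bigmax_seq (F := id) i.+1); first by rewrite mem_index_iota.
  by rewrite subn1 addn1.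
(* The maximum is either the default 0 or attained at a qualifying index; monotonicity then covers
   all smaller indices. *)
have : durfee r a = 0 \/ r * (durfee r a - 1) + 1 <= entry a (durfee r a).
  rewrite /durfee; elim/big_ind: _ => [|x y Hx Hy|j Hj]; [by left| |by right].
  by case: (leqP x y).
case=> [m0|]; first by rewrite m0 in im.
rewrite /entry; have : i <= (durfee r a).-1 by lia.
by move=> /[dup] /fmono; nia.
Qed.

Lemma dominated_packed (r n : nat) (a : n.-tuple nat) :
  dominated a (col_sums (packed_mx r a)) <-> forall k, 1 <= k <= n -> C2 r a k.
Proof.
have E k : k <= n -> \sum_(1 <= i < k.+1) entry (col_sums (packed_mx r a)) i =
    packed_sum n r (nth 0 a) k.
  move=> kn; rewrite col_sums_prefix // /packed_sum.
  transitivity (\sum_(0 <= i < n) minn (r * (k - (i < k))) (nth 0 a i)).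
    rewrite big_mkord; apply: eq_bigr => i _.
    by rewrite row_prefix_packed // (tnth_nth 0).
  rewrite (big_cat_nat (n := k)) //=; congr (_ + _).
    by apply: eq_big_nat => i /andP[_ ->].
  by apply: eq_big_nat => i /andP[ki _]; rewrite ltnNge ki subn0.
split=> H k /[dup] /H + kn; rewrite C2E -E ?(sum_entry a id) //; lia.
Qed.

(** * Conjugate sequences and their corners *)

Lemma conjugateE (n : nat) (a : n.-tuple nat) (l : nat) :
  conjugate a l = \sum_(0 <= i < n) (l <= nth 0 a i).
Proof.
by rewrite /conjugate -sum1_count big_mkcond (big_nth 0) size_tuple.
Qed.

Lemma lt_conjugate (n : nat) (a : n.-tuple nat) (l i : nat) : sorted geq a ->
  i < n -> (i < conjugate a l) = (l <= nth 0 a i).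
Proof.
move=> /sorted_nth_noninc fmono i_n; rewrite conjugateE.
apply: (@sum_threshold (fun i => l <= nth 0 a i)) => // x y /fmono; lia.
Qed.

(** Double counting of the cells of the Ferrers diagram at levels [b.+1] to [c]. *)
Lemma sum_conjugate (n : nat) (a : n.-tuple nat) (b c : nat) :
  \sum_(b.+1 <= l < c.+1) conjugate a l =
  \sum_(0 <= i < n) (minn c (nth 0 a i) - b).
Proof.
under eq_bigr => l _ do rewrite conjugateE.
rewrite exchange_big_nat /=; apply: eq_bigr => i _; move: (nth 0 a i) => x.
elim: c => [|c IH]; first by rewrite big_geq //; lia.
have [bc|cb] := leqP b c; first by rewrite big_nat_recr //= IH; lia.
by rewrite big_geq //; lia.
Qed.

(** Exactly the first [conjugate a j] entries are at least [j]. Each is [j] plus its excess, and the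
    conjugate entries beyond [j] count the excesses. *)
Lemma sum_conjugate_max (n : nat) (a : n.-tuple nat) (j : nat) : sorted geq a ->
  j * conjugate a j + \sum_(j.+1 <= i < (max_entry a).+1) conjugate a i =
  \sum_(0 <= i < conjugate a j) nth 0 a i.
Proof.
move=> a_noninc; set k := conjugate a j.
have kn : k <= n by rewrite /k conjugateE; apply: sum_indicator_le.
rewrite sum_conjugate (big_cat_nat (n := k)) //=.
rewrite [X in _ + (_ + X)]big1_seq ?addn0.
  have -> : j * k = \sum_(0 <= i < k) j by rewrite sum_nat_const_nat subn0 mulnC.
  rewrite -big_split /=; apply: eq_big_nat => i /andP[_ ik].
  have i_n := leq_trans ik kn; have := ik; rewrite lt_conjugate //.
  have /minn_idPr -> : nth 0 a i <= max_entry a.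
    by apply: (leq_bigmax_seq (F := id)) => //; rewrite mem_nth ?size_tuple.
  by lia.
move=> i; rewrite mem_index_iota => /= /andP[ki i_n].
by have := lt_conjugate j a_noninc i_n; rewrite -/k; lia.
Qed.

(** Put [k = conjugate a j]. The right side is the sum of all [minn (r * k) (nth 0 a i)], minus
    [r * k]. As [k < m], the first [k] minima equal [r * k], which leaves [r * k * (k - 1)] plus the
    tail of (C1_k). *)
Lemma conjugate_ineqE (r n : nat) (a : n.-tuple nat) (j : nat) : sorted geq a ->
  conjugate a j < durfee r a ->
  conjugate_ineq r a j <-> C1 r a (conjugate a j).
Proof.
move=> a_noninc; rewrite /conjugate_ineq sum_conjugate_max // C1E /erdos_gallai.
move: (conjugate a j) => k km; have kn := leq_trans (ltnW km) (durfee_le r a).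
have -> : (\sum_(1 <= i < (r * k).+1) ((conjugate a i)%:Z - 1) =
    (\sum_(1 <= i < (r * k).+1) conjugate a i)%N%:Z - (r * k)%:Z)%R.
  rewrite GRing.sumrB -(big_morph Posz PoszD erefl) GRing.sumr_const_nat subn1.
  by rewrite /= natz.
rewrite sum_conjugate (eq_bigr _ (fun i _ => subn0 _)).
rewrite [X in (_ <= X%:Z - _)%R](big_cat_nat (n := k)) //=.
have -> : \sum_(0 <= i < k) minn (r * k) (nth 0 a i) = k * (r * k).
  rewrite -[X in X * (r * k)](subn0 k) -sum_nat_const_nat.
  apply: eq_big_nat => i /andP[_ ik]; apply/minn_idPl.
  have := durfeeP r a_noninc (leq_trans km (durfee_le r a)); rewrite km => /esym fk.
  exact: leq_trans (ltnW fk) (sorted_nth_noninc a_noninc (ltnW ik)).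
by case: (posnP k) => [->|k0]; [rewrite ?muln0; lia|nia].
Qed.

Lemma corner_conjugate (n : nat) (a : n.-tuple nat) (k : nat) : sorted geq a ->
  k < n -> corner a k ->
  conjugate_corner a (entry a k) /\ conjugate a (entry a k) = k.
Proof.
move=> a_noninc kn /andP[/andP[k0 _]]; rewrite /entry /= => fk.
have k1n : k.-1 < n by lia.
have cE l := lt_conjugate l a_noninc kn; have cE' l := lt_conjugate l a_noninc k1n.
set j := nth 0 a k.-1 in fk *.
have := cE j; have := cE' j; have := cE' j.+1; rewrite -/j leqnn ltnn => c1 c2 c3.
have ck : conjugate a j = k by lia.
by split=> //; rewrite /conjugate_corner ck; lia.
Qed.

Lemma conjugate_corner_corner (n : nat) (a : n.-tuple nat) (j : nat) :
    sorted geq a -> conjugate_corner a j -> conjugate a j < n ->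
  corner a (conjugate a j).
Proof.
move=> a_noninc /andP[j0 cj] cn; rewrite /corner /entry /=.
have c1n : (conjugate a j).-1 < n by lia.
have := lt_conjugate j a_noninc cn; have := lt_conjugate j a_noninc c1n.
by rewrite ltnn; lia.
Qed.

(** * The cycle of implications between the six conditions *)

Theorem theorem3p11 (n r : nat) (a : n.-tuple nat)
    (a_noninc : sorted geq a)
    (a_bound : max_entry a <= r * (n - 1))
    (a_even : ~~ odd (\sum_(1 <= i < n.+1) entry a i)) :
  let m := durfee r a in
  [<-> rmultigraphic r a;
       exists2 aC : n.-tuple nat, is_aC r a aC & dominated a aC;
       forall k : nat, 1 <= k <= n -> C1 r a k;
       C1 r a m /\ (forall k : nat, corner a k -> k < m -> C1 r a k);
       C2 r a m /\ (forall k : nat, corner a k -> k < m -> C2 r a k);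
       C2 r a m /\ (forall j : nat, conjugate_corner a j -> conjugate a j < m ->
                      conjugate_ineq r a j)].
Proof.
move=> m; pose f := nth 0 a.
have fmono : noninc f by apply: sorted_nth_noninc.
have mn : m <= n by apply: durfee_le.
have mE i : i < n -> (i < m) = (r * i < f i) by apply: durfeeP.
have C12 k : k <= m -> C2 r a k <-> C1 r a k.
  by move=> km; rewrite C1E C2E (packed_sum_le_durfee fmono mn mE).
have C1all : (forall k, 1 <= k <= n -> C1 r a k) ->
    forall k, k <= n -> erdos_gallai n r f k.
  move=> H [|k] kn; first by rewrite /erdos_gallai big_geq.
  by apply/C1E/H.
tfae.
- move=> /rmultigraphic_realizable Hreal.
  exists (col_sums (packed_mx r a)); first exact/is_aCP.
  apply/dominated_packed => k /andP[_ kn]; apply/C2E.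
  apply: erdos_gallai_packed => // l; exact: realizable_erdos_gallai.
- move=> [aC /(is_aCP _ a_bound) -> /dominated_packed H] k /H /C2E kC2.
  exact/C1E/packed_erdos_gallai.
- move=> /C1all H; split=> [|k _ km]; apply/C1E/H => //.
  exact: leq_trans (ltnW km) mn.
- by move=> [H Hc]; split=> [|k kc km]; apply/C12 => //; [apply: ltnW|apply: Hc].
- move=> [H Hc]; split=> // j jc jm; apply/conjugate_ineqE => //.
  apply/C12; first exact: ltnW.
  apply: Hc (jm); apply: conjugate_corner_corner => //.
  exact: leq_trans jm mn.
- move=> [/(C12 _ (leqnn m))/C1E Hm Hc].
  apply/rmultigraphic_realizable; apply: erdos_gallai_realizable => //.
  + by move=> i ni; rewrite nth_default // size_tuple.
  + by rewrite -(sum_entry a id).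
  apply: (erdos_gallai_corners fmono mn mE Hm) => k /andP[k0 km] fk.
  have kn := leq_trans km mn.
  (* The corner [k] is reached from the corner [entry a k] of the conjugate, to which the hypothesis
     applies. *)
  have [|jc jk] := @corner_conjugate n a k a_noninc kn.
    by rewrite /corner k0 (ltnW kn).
  apply/C1E; rewrite -jk; apply/conjugate_ineqE; rewrite ?jk //.
  by apply: Hc; rewrite ?jk.
Qed.
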